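(* Let $\underline{w}=(s_1,\ldots,s_n)$ be an expression in a Coxeter system $(W,S)$, and let $\underline{w}'=(s_1',\ldots,s_n')$ be an expression in a possibly different Coxeter system $(W',S')$. If $m_{s_is_j}=m_{s_i's_j'}$ for all $1\le i\le j\le n$, then $\overline{\mathrm{BS}}(\underline{w})\cong\overline{\mathrm{BS}}(\underline{w}')$ as graded $\mathbb{R}$-algebras.
   Context: A Coxeter system $(W,S)$ has $S$ finite, $W=\langle s\in S\mid (st)^{m_{st}}=\mathrm{id}\text{ for } s,t\in S,\ m_{st}<\infty\rangle$, with $m_{ss}=1$ and $m_{st}=m_{ts}\in\{2,3,\ldots\}\cup\{\infty\}$ for $s\ne t$. Convention: $\pi/m_{st}=0$ if $m_{st}=\infty$. An expression is a finite sequence of elements of $S$, not necessarily reduced. Geometric representation: $V$ is the real vector space with basis $\{\alpha_s\mid s\in S\}$ and symmetric bilinear form $(\alpha_s,\alpha_t)=-\cos\frac{\pi}{m_{st}}$; $s\in S$ acts by $s(\lambda)=\lambda-2(\lambda,\alpha_s)\alpha_s$. Let $R=\operatorname{Sym}(V)=\mathbb{R}[\alpha_s\mid s\in S]$, graded with $\deg\alpha_s=1$, with the induced action of $W$ by algebra automorphisms. $R^s$ is the subring of $s$-invariant polynomials. Bott--Samelson ring: $\overline{\mathrm{BS}}(\underline{w}):=\mathbb{R}\otimes_{R^{s_1}}R\otimes_{R^{s_2}}\cdots\otimes_{R^{s_n}}R$, where $R$ (hence $R^{s_1}$) acts on $\mathbb{R}$ through the quotient map $R\to\mathbb{R}$ killing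 all elements of positive degree; multiplication is componentwise, and the grading is induced from $R$. $\overline{\mathrm{BS}}(\underline{w}')$ is defined in the same way from $(W',S')$ and its own geometric representation. *)

(* Defs.v *)
From HB Require Import structures.
From mathcomp Require Import all_boot all_order all_algebra.
From mathcomp Require Import freeg mpoly.
From mathcomp Require Import boolp reals trigo.

Set Implicit Arguments.
Unset Strict Implicit.
Unset Printing Implicit Defensive.

Import Order.TTheory GRing.Theory Num.Theory.

Local Open Scope ring_scope.
Local Open Scope quotient_scope.

(* Biadditive extension of the componentwise product (b, c)(b', c') =         *)
(* (bb', cc') to the free abelian group on B * C.                             *)
Section FreeProduct.
Variables (B C : comPzRingType).
Local Notation F := {freeg (B * C)%type}.
Implicit Types (x y z : F) (p q : B * C).

Definition pmul p q : B * C := (p.1 * q.1, p.2 * q.2).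

Definition fmul x y : F :=
  fglift (fun p => fglift (fun q => << pmul p q >> : F) y) x.

HB.instance Definition _ (M : lmodType int) (h : B * C -> M) :=
  GRing.isZmodMorphism.Build F M (fglift h) (lift_is_additive h).

Lemma fgliftE (M : lmodType int) (h : B * C -> M) x :
  fglift h x = \sum_(k <- dom x) coeff k x *: h k.
Proof.
by rewrite -{1}[x]freeg_sumE raddf_sum; apply: eq_bigr => k _ /=; rewrite liftU.
Qed.

Lemma fmulC : commutative fmul.
Proof.
move=> x y; rewrite /fmul fgliftE.
under eq_bigr do rewrite fgliftE scaler_sumr.
rewrite exchange_big fgliftE; apply: eq_bigr => q _.
rewrite fgliftE scaler_sumr; apply: eq_bigr => p _.
by rewrite !scalerA mulrC /pmul ![q.1 * _]mulrC ![q.2 * _]mulrC.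
Qed.

Lemma fmulDl : left_distributive fmul +%R.
Proof. by move=> x y z; rewrite /fmul raddfD. Qed.

Lemma fmulDr : right_distributive fmul +%R.
Proof. by move=> x y z; rewrite fmulC fmulDl !(fmulC x). Qed.

Lemma fmul0l y : fmul 0 y = 0. Proof. by rewrite /fmul raddf0. Qed.

Lemma fmulBl x y z : fmul (x - y) z = fmul x z - fmul y z.
Proof. by rewrite /fmul raddfB. Qed.

Lemma fmulUU p q : fmul << p >> << q >> = << pmul p q >>.
Proof. by rewrite /fmul !liftU !scale1r. Qed.

Lemma freeg_addind (P : F -> Prop) :
  (forall p, P << p >>) -> P 0 -> (forall x y, P x -> P y -> P (x - y)) ->
  forall x, P x.
Proof.
move=> PU P0 PB x.
have PN y : P y -> P (- y) by move=> Py; rewrite -[- y]add0r; apply: PB.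
have PD y z : P y -> P z -> P (y + z).
  by move=> Py /PN Pz; rewrite -[z]opprK; apply: PB.
have PMn y n : P y -> P (y *+ n).
  by move=> Py; elim: n => [|n IH]; rewrite ?mulr0n // mulrS; apply: PD.
rewrite -[x]freeg_sumE; elim/big_ind: _ => // k _.
rewrite -[coeff k x]intz -freegU_mulz; case: (coeff k x) => n.
  by rewrite -pmulrn; apply: PMn.
by rewrite NegzE mulrNz -pmulrn; apply/PN/PMn.
Qed.

Lemma fmul1l y : fmul << (1, 1) >> y = y.
Proof.
elim/freeg_addind: y => [[b c]||x y IHx IHy].
- by rewrite fmulUU /pmul /= !mul1r.
- by rewrite fmulC fmul0l.
- by rewrite fmulC fmulBl ![fmul _ << _ >>]fmulC IHx IHy.
Qed.

Lemma fmulA : associative fmul.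
Proof.
move=> x y z; elim/freeg_addind: x => [p||x x' IH IH']; last 2 first.
- by rewrite !fmul0l.
- by rewrite !fmulBl IH IH'.
elim/freeg_addind: y => [q||y y' IH IH']; last 2 first.
- by rewrite fmul0l [fmul _ 0]fmulC !fmul0l.
- rewrite fmulBl [LHS]fmulC fmulBl ![fmul _ << p >>]fmulC IH IH'.
  by rewrite [fmul _ (y - y')]fmulC !fmulBl ![fmul _ << p >>]fmulC.
elim/freeg_addind: z => [r||z z' IH IH'].
- by rewrite !fmulUU /pmul /= !mulrA.
- by rewrite ![fmul _ 0]fmulC !fmul0l fmulC fmul0l.
- rewrite ![fmul _ (z - z')]fmulC !fmulBl ![fmul _ (fmul << p >> _)]fmulC.
  by rewrite [LHS]fmulC fmulBl ![fmul _ << p >>]fmulC ![fmul z _]fmulC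
    ![fmul z' _]fmulC IH IH'.
Qed.

End FreeProduct.

(* tensor f g is the tensor product over A of two commutative A-algebras with *)
(* structure morphisms f : A -> B and g : A -> C: the quotient of the free    *)
(* abelian group on B * C by the subgroup generated by the biadditivity and   *)
(* A-balancedness relators, with componentwise multiplication.                *)
Section Tensor.
Variables (A B C : comPzRingType).
Variables (f : {rmorphism A -> B}) (g : {rmorphism A -> C}).
Local Notation F := {freeg (B * C)%type}.
Implicit Types (x y z : F).

Inductive tensor_rel : F -> Prop :=
| TensorRel0 : tensor_rel 0
| TensorRelB x y : tensor_rel x -> tensor_rel y -> tensor_rel (x - y)
| TensorRelDl b b' c :
    tensor_rel (<< (b + b', c) >> - << (b, c) >> - << (b', c) >>)
| TensorRelDr b c c' :
    tensor_rel (<< (b, c + c') >> - << (b, c) >> - << (b, c') >>)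
| TensorRelA a b c : tensor_rel (<< (b * f a, c) >> - << (b, g a * c) >>).

Definition tensor_relb : pred F := fun x => `[< tensor_rel x >].

Lemma tensor_rel_zmod_closed : zmod_closed tensor_relb.
Proof.
split=> [|x y]; first exact/asboolP/TensorRel0.
by move=> /asboolP rx /asboolP ry; apply/asboolP/TensorRelB.
Qed.

HB.instance Definition _ :=
  GRing.isZmodClosed.Build F tensor_relb tensor_rel_zmod_closed.

Definition tensor_sub : zmodClosed F := GRing.ZmodClosed.clone F tensor_relb _.

Definition tensor : Type := Quotient.quot tensor_sub.
HB.instance Definition _ := GRing.Zmodule.on tensor.
HB.instance Definition _ := Quotient.on tensor.

Definition tpi (x : F) : tensor := \pi_(Quotient.quot tensor_sub) x.

Lemma tpi_is_zmod_morphism : zmod_morphism tpi.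
Proof. exact: raddfB. Qed.

HB.instance Definition _ :=
  GRing.isZmodMorphism.Build F tensor tpi tpi_is_zmod_morphism.

Lemma tpi_eq x y : (tpi x = tpi y) <-> tensor_rel (x - y).
Proof.
have E : (tpi x == tpi y) = tensor_relb (x - y).
  exact: esym (Quotient.idealrBE tensor_sub x y).
by split=> [/eqP|h]; [rewrite E => /asboolP|apply/eqP; rewrite E; apply/asboolP].
Qed.

Lemma tpi0 x : tensor_rel x -> tpi x = 0.
Proof. by move=> h; rewrite -(raddf0 tpi); apply/tpi_eq; rewrite subr0. Qed.

Definition trepr (X : tensor) : F := repr (X : Quotient.quot tensor_sub).

Lemma treprK : cancel trepr tpi.
Proof. exact: reprK. Qed.

Lemma fmul_rel x y : tensor_rel x -> tensor_rel (fmul x y).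
Proof.
move=> rx; elim/freeg_addind: y => [[b' c']||y y' IH IH']; last 2 first.
- by rewrite fmulC fmul0l; apply: TensorRel0.
- by rewrite fmulC fmulBl ![fmul _ x]fmulC; apply: TensorRelB.
elim: x / rx => [|x y _ IHx _ IHy|b1 b2 c|b c1 c2|a b c].
- by rewrite fmul0l; apply: TensorRel0.
- by rewrite fmulBl; apply: TensorRelB.
- by rewrite !fmulBl !fmulUU /pmul /= mulrDl; apply: TensorRelDl.
- by rewrite !fmulBl !fmulUU /pmul /= mulrDl; apply: TensorRelDr.
- by rewrite fmulBl !fmulUU /pmul /= (mulrAC b) -(mulrA (g a)); apply: TensorRelA.
Qed.

Definition tone : tensor := tpi << (1, 1) >>.
Definition tmul (X Y : tensor) : tensor := tpi (fmul (trepr X) (trepr Y)).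

Lemma tpiM x y : tpi (fmul x y) = tmul (tpi x) (tpi y).
Proof.
have sub (u v : F) : tpi u = tpi v -> forall w, tpi (fmul u w) = tpi (fmul v w).
  by move=> /tpi_eq uv w; apply/tpi_eq; rewrite -fmulBl; apply: fmul_rel.
rewrite /tmul (sub x (trepr (tpi x))) ?treprK // fmulC.
by rewrite (sub y (trepr (tpi y))) ?treprK // fmulC.
Qed.

Lemma tmulA : associative tmul.
Proof.
by move=> X Y Z; rewrite -[X]treprK -[Y]treprK -[Z]treprK -!tpiM fmulA.
Qed.

Lemma tmulC : commutative tmul.
Proof. by move=> X Y; rewrite /tmul fmulC. Qed.

Lemma tmul1 : left_id tone tmul.
Proof. by move=> X; rewrite -[X]treprK -tpiM fmul1l. Qed.

Lemma tmulDl : left_distributive tmul +%R.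
Proof.
move=> X Y Z; rewrite -[X]treprK -[Y]treprK -[Z]treprK -raddfD -!tpiM.
by rewrite fmulDl raddfD.
Qed.

HB.instance Definition _ :=
  GRing.Zmodule_isComPzRing.Build tensor tmulA tmulC tmul1 tmulDl.

Definition tens (b : B) (c : C) : tensor := tpi << (b, c) >>.

Lemma tensM b b' c c' : tens b c * tens b' c' = tens (b * b') (c * c').
Proof. by rewrite /tens -[LHS]tpiM fmulUU. Qed.

Lemma tensDl b b' c : tens (b + b') c = tens b c + tens b' c.
Proof.
apply/eqP; rewrite -subr_eq0 opprD addrA -!raddfB /=.
by apply/eqP/tpi0/TensorRelDl.
Qed.

Lemma tensDr b c c' : tens b (c + c') = tens b c + tens b c'.
Proof.
apply/eqP; rewrite -subr_eq0 opprD addrA -!raddfB /=.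
by apply/eqP/tpi0/TensorRelDr.
Qed.

Lemma tensA a b c : tens (b * f a) c = tens b (g a * c).
Proof. exact/tpi_eq/TensorRelA. Qed.

Definition tensl (b : B) : tensor := tens b 1.
Definition tensr (c : C) : tensor := tens 1 c.

Lemma tensl_is_nmod_morphism : nmod_morphism tensl.
Proof.
split=> [|b b']; last exact: tensDl.
by apply: (addrI (tensl 0)); rewrite -tensDl !addr0.
Qed.

Lemma tensl_is_monoid_morphism : monoid_morphism tensl.
Proof. by split=> // b b'; rewrite /tensl tensM mulr1. Qed.

HB.instance Definition _ :=
  GRing.isNmodMorphism.Build B tensor tensl tensl_is_nmod_morphism.
HB.instance Definition _ :=
  GRing.isMonoidMorphism.Build B tensor tensl tensl_is_monoid_morphism.

Lemma tensr_is_nmod_morphism : nmod_morphism tensr.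
Proof.
split=> [|c c']; last exact: tensDr.
by apply: (addrI (tensr 0)); rewrite -tensDr !addr0.
Qed.

Lemma tensr_is_monoid_morphism : monoid_morphism tensr.
Proof. by split=> // c c'; rewrite /tensr tensM mulr1. Qed.

HB.instance Definition _ :=
  GRing.isNmodMorphism.Build C tensor tensr tensr_is_nmod_morphism.
HB.instance Definition _ :=
  GRing.isMonoidMorphism.Build C tensor tensr tensr_is_monoid_morphism.

Lemma tensor_lift (D : comPzRingType) (h : {rmorphism B -> D})
    (k : {rmorphism C -> D}) :
  (forall a, h (f a) = k (g a)) ->
  exists u : {rmorphism tensor -> D}, forall b c, u (tens b c) = h b * k c.
Proof.
move=> hk; pose v (x : F) : D := fglift (fun p => h p.1 * k p.2 : zmodule D) x.
have vB : {morph v : x y / x - y} by move=> x y; rewrite /v raddfB.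
have v0 : v 0 = 0 by rewrite -(subrr 0) vB subrr.
have vU p : v << p >> = h p.1 * k p.2 by rewrite /v liftU scale1r.
have vM x y : v (fmul x y) = v x * v y.
  elim/freeg_addind: x => [p||x x' IH IH']; last 2 first.
  - by rewrite fmul0l v0 mul0r.
  - by rewrite fmulBl !vB IH IH' mulrBl.
  elim/freeg_addind: y => [q||y y' IH IH'].
  - by rewrite fmulUU !vU /pmul /= !rmorphM mulrACA.
  - by rewrite fmulC fmul0l v0 mulr0.
  - by rewrite fmulC fmulBl ![fmul _ << _ >>]fmulC !vB IH IH' mulrBr.
have vrel x : tensor_rel x -> v x = 0.
  elim=> [|{}x y _ vx _ vy|b b' c|b c c'|a b c].
  - exact: v0.
  - by rewrite vB vx vy subrr.
  - by rewrite !vB !vU /= raddfD /= mulrDl addrAC addrK subrr.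
  - by rewrite !vB !vU /= raddfD /= mulrDr addrAC addrK subrr.
  - by rewrite vB !vU /= !rmorphM hk mulrA subrr.
pose u (X : tensor) : D := v (trepr X).
have uE x : u (tpi x) = v x.
  by apply/eqP; rewrite -subr_eq0 -vB; apply/eqP/vrel/tpi_eq; rewrite treprK.
have uB : zmod_morphism u.
  by move=> X Y; rewrite -[X]treprK -[Y]treprK -raddfB !uE vB.
have uM : monoid_morphism u.
  split=> [|X Y]; first by rewrite uE vU /= !rmorph1 mulr1.
  by rewrite -[X]treprK -[Y]treprK -[_ * _]tpiM !uE vM.
pose ua := GRing.isZmodMorphism.Build _ _ u uB.
pose um := GRing.isMonoidMorphism.Build _ _ u uM.
pose U : {rmorphism tensor -> D} := HB.pack u ua um.
by exists U => b c; rewrite /= uE vU.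
Qed.

End Tensor.

Arguments tensl {A B C} f g b.
Arguments tensr {A B C} f g c.
Arguments tens {A B C} f g b c.

(* W is presented by generators S and relators (st)^(m s t), m s t < oo, when *)
(* the relators hold in W and W is universal among groups with this property. *)
Section CoxeterPresentation.
Local Open Scope group_scope.

Definition coxeter_relations (S : finType) (m : S -> S -> option nat)
    (G : groupType) (h : S -> G) :=
  forall s t k, m s t = Some k -> (h s * h t) ^+ k = 1.

Definition coxeter_presentation (S : finType) (m : S -> S -> option nat)
    (W : groupType) (gen : S -> W) :=
  coxeter_relations m gen /\
  forall (G : groupType) (h : S -> G), coxeter_relations m h ->
    exists u : W -> G,
      [/\ {morph u : x y / x * y}, forall s, u (gen s) = h s
        & forall u' : W -> G, {morph u' : x y / x * y} ->
            (forall s, u' (gen s) = h s) -> u' =1 u].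

End CoxeterPresentation.

(* cox_m s t = None encodes an infinite label.                                *)
Record coxeterSystem := CoxeterSystem {
  cox_group : groupType;
  cox_gens : finType;
  cox_elt : cox_gens -> cox_group;
  cox_m : cox_gens -> cox_gens -> option nat;
  cox_m_diag : forall s, cox_m s s = Some 1%N;
  cox_m_sym : forall s t, cox_m s t = cox_m t s;
  cox_m_ge2 : forall s t k, s != t -> cox_m s t = Some k -> (2 <= k)%N;
  cox_presented : coxeter_presentation cox_m cox_elt
}.

Section GeometricRepresentation.
Variables (K : realType) (C : coxeterSystem).
Local Notation S := (cox_gens C).
Local Notation N := #|{: S}|.
Local Notation V := 'rV[K]_N.
Implicit Types (s t : S).

Definition cox_angle s t : K :=
  if cox_m s t is Some k then pi / k%:R else 0.

Definition simple_root s : V := delta_mx 0 (enum_rank s).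

Definition geom_form (x y : V) : K :=
  \sum_s \sum_t x 0 (enum_rank s) * y 0 (enum_rank t) * - cos (cox_angle s t).

Definition geom_refl s (x : V) : V :=
  x - (2 * geom_form x (simple_root s)) *: simple_root s.

(* Sym(V) is the polynomial ring with one variable per simple root: 'X_i is   *)
(* the image of simple_root (enum_val i) under linear_poly.                   *)
Definition symV := {mpoly K[N]}.
HB.instance Definition _ := GRing.ComAlgebra.on symV.

Definition linear_poly (x : V) : symV := \sum_(i < N) x 0 i *: 'X_i.

Definition sym_act s (p : symV) : symV :=
  p \mPo [tuple linear_poly (geom_refl s (simple_root (enum_val i))) | i < N].

Definition invariant s : pred symV := fun p => sym_act s p == p.

Lemma invariant_subring_closed s : subring_closed (invariant s).
Proof.
split=> [|p q|p q]; rewrite -!topredE /= /invariant /sym_act.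
- by rewrite rmorph1.
- by move=> /eqP ep /eqP eq; rewrite rmorphB /= ep eq.
- by move=> /eqP ep /eqP eq; rewrite rmorphM /= ep eq.
Qed.

Record inv_ring s := InvRing { inv_val : symV; _ : invariant s inv_val }.

Section InvRingInstances.
Variable s : S.
HB.instance Definition _ := [isSub for @inv_val s].
HB.instance Definition _ := [Choice of inv_ring s by <:].
HB.instance Definition _ := GRing.SubChoice_isSubComPzRing.Build symV
  (invariant s) (inv_ring s) (invariant_subring_closed s).
End InvRingInstances.

Definition inv_incl s : {rmorphism inv_ring s -> symV} := val.

(* Bott-Samelson rings are built left to right.  bs_scal is the structure map *)
(* over K; bs_last is the map from Sym(V) into the last tensor factor, or the *)
(* quotient map to K for the empty expression; bs_homog d is membership in    *)
(* the degree d component.                                                    *)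
Record bsData := BSData {
  bs_ring : comPzRingType;
  bs_scal : {rmorphism K -> bs_ring};
  bs_last : {rmorphism symV -> bs_ring};
  bs_homog : nat -> bs_ring -> Prop
}.

Definition bs_nil : bsData :=
  {| bs_ring := K; bs_scal := idfun; bs_last := mcoeff 0%MM;
     bs_homog := fun d x => d = 0%N \/ x = 0 |}.

(* From B, form the tensor product of B and R = Sym(V) over R^s, where R^s    *)
(* acts on B through the last tensor factor of B.                             *)
Section Step.
Variables (X : bsData) (s : S).

Definition step_left : {rmorphism inv_ring s -> bs_ring X} :=
  bs_last X \o inv_incl s.

(* The degree d component is spanned by the tensors of a homogeneous element  *)
(* of degree i and a homogeneous element of degree d - i.                     *)
Definition step_homog d (z : tensor step_left (inv_incl s)) : Prop :=
  exists2 r : seq (bs_ring X * symV),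
    z = \sum_(p <- r) tens step_left (inv_incl s) p.1 p.2
    & forall p, p \in r -> exists i j : nat,
        [/\ (i + j)%N = d, bs_homog i p.1 & p.2 \is j.-homog].

Definition bs_step : bsData :=
  {| bs_ring := tensor step_left (inv_incl s);
     bs_scal := tensl step_left (inv_incl s) \o bs_scal X;
     bs_last := tensr step_left (inv_incl s);
     bs_homog := step_homog |}.

End Step.

Definition bs_data (w : seq S) : bsData := foldl bs_step bs_nil w.

Lemma bs_augmentation w :
  exists u : {rmorphism bs_ring (bs_data w) -> K},
    forall p : symV, u (bs_last (bs_data w) p) = mcoeff 0%MM p.
Proof.
rewrite /bs_data; elim/last_ind: w => [|w s [u uE]].
  by exists (idfun : {rmorphism K -> K}).
rewrite foldl_rcons; set X := foldl _ _ w in u uE *.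
have [a|v vE] := @tensor_lift _ _ _ (step_left X s) (inv_incl s) K u
  (mcoeff 0%MM : {rmorphism symV -> K}); first exact: uE.
by exists v => p; rewrite /= /tensr vE rmorph1 mul1r.
Qed.

Definition BS (w : seq S) : Type := bs_ring (bs_data w).

Section BSAlgebra.
Variable w : seq S.
HB.instance Definition _ := GRing.ComPzRing.on (BS w).

Lemma BS_oner_neq0 : 1 != 0 :> BS w.
Proof.
have [u _] := bs_augmentation w; apply/eqP => /(congr1 u)/eqP.
by rewrite rmorph1 rmorph0 oner_eq0.
Qed.

HB.instance Definition _ :=
  GRing.PzSemiRing_isNonZero.Build (BS w) BS_oner_neq0.

Definition BS_scale (a : K) (x : BS w) : BS w := bs_scal (bs_data w) a * x.

Lemma BS_scaleA a b x : BS_scale a (BS_scale b x) = BS_scale (a * b) x.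
Proof. by rewrite /BS_scale rmorphM mulrA. Qed.

Lemma BS_scale1 : left_id 1 BS_scale.
Proof. by move=> x; rewrite /BS_scale rmorph1 mul1r. Qed.

Lemma BS_scaleDr : right_distributive BS_scale +%R.
Proof. by move=> a x y; apply: mulrDr. Qed.

Lemma BS_scaleDl x : {morph BS_scale^~ x : a b / a + b}.
Proof. by move=> a b; rewrite /BS_scale rmorphD mulrDl. Qed.

HB.instance Definition _ := GRing.Zmodule_isLmodule.Build K (BS w)
  BS_scaleA BS_scale1 BS_scaleDr BS_scaleDl.

Lemma BS_scaleAl a (x y : BS w) : a *: (x * y) = (a *: x) * y.
Proof. exact: mulrA. Qed.

HB.instance Definition _ :=
  GRing.Lmodule_isLalgebra.Build K (BS w) BS_scaleAl.
HB.instance Definition _ := GRing.Lalgebra_isComAlgebra.Build K (BS w).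
End BSAlgebra.

Definition BS_homog (w : seq S) (d : nat) (x : BS w) : Prop :=
  bs_homog (b := bs_data w) d x.

End GeometricRepresentation.

(* Main.v *)
(** The Gram matrix of the roots alpha_(s_i) determines the ring.  For a linear
    form x, the image of x in the i-th tensor factor is
    [\sum_(j <= i) (x, alpha_(s_j)) u_j], where u_j is the difference of the
    images of alpha_(s_j) in the factors j and j - 1, and the relations are
    [u_i (u_i + 2 \sum_(j < i) (alpha_(s_i), alpha_(s_j)) u_j) = 0].  The
    isomorphism matching the u_i is built one tensor factor at a time, in both
    directions, by the universal property of the tensor product.  Linear forms of
    the two representations cannot be matched with each other in general; those
    having the same pairings with the roots of the expressions have matching
    images, and this covers the roots needed at the next step. *)

Require Import Defs.
From mathcomp Require Import all_boot all_order all_algebra.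
From mathcomp Require Import freeg mpoly.
From mathcomp Require Import boolp reals trigo.
From HB Require Import structures.
From mathcomp Require Import ring.

Set Implicit Arguments.
Unset Strict Implicit.
Unset Printing Implicit Defensive.

Import Order.TTheory GRing.Theory Num.Theory.

Local Open Scope ring_scope.

(** * Ring morphisms out of polynomial rings and tensor products *)

Section PolynomialMorphisms.
Variables (K : comNzRingType) (n : nat).

(** Closure under arbitrary products replaces induction on monomials; this suits properties such as
    the decomposition over invariants used below. *)
Lemma mpoly_ring_ind (P : {mpoly K[n]} -> Prop) :
  (forall c, P c%:MP) -> (forall i, P 'X_i) ->
  (forall p q, P p -> P q -> P (p + q)) ->
  (forall p q, P p -> P q -> P (p * q)) -> forall p, P p.
Proof.
move=> PC PX PD PM p; rewrite [p]mpolyE.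
apply: big_ind => [|q r|m _]; [by rewrite -mpolyC0|exact: PD|].
rewrite -mul_mpolyC; apply: (PM) => //; rewrite mpolyXE_id.
apply: big_ind => [|q r|i _]; [by rewrite -mpolyC1|exact: PM|].
by elim: (m i) => [|k IH]; rewrite ?expr0 -?mpolyC1 // exprS; apply: (PM).
Qed.

Lemma mpoly_rmorph_ext (D : pzSemiRingType)
    (g h : {rmorphism {mpoly K[n]} -> D}) :
  (forall c, g c%:MP = h c%:MP) -> (forall i, g 'X_i = h 'X_i) -> g =1 h.
Proof.
move=> ghC ghX; elim/mpoly_ring_ind => // p q IHp IHq.
- by rewrite !rmorphD IHp IHq.
- by rewrite !rmorphM IHp IHq.
Qed.

(* mmap requires a nontrivial target, which need not be the case for D. *)
Lemma mpoly_lift (D : comPzRingType) (f : {rmorphism K -> D}) (h : 'I_n -> D) :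
  exists k : {rmorphism {mpoly K[n]} -> D},
    (forall c, k c%:MP = f c) /\ (forall i, k 'X_i = h i).
Proof.
have [D0|D1] := eqVneq (1 : D) 0.
  have E (x y : D) : x = y by rewrite -[x]mul1r -[y]mul1r D0 !mul0r.
  pose z (p : {mpoly K[n]}) : D := 0.
  have zB : zmod_morphism z by move=> p q; apply: E.
  have zM : monoid_morphism z by split=> [|p q]; apply: E.
  pose za := GRing.isZmodMorphism.Build _ _ z zB.
  pose zm := GRing.isMonoidMorphism.Build _ _ z zM.
  pose Z : {rmorphism {mpoly K[n]} -> D} := HB.pack z za zm.
  by exists Z; split=> *; apply: E.
pose nz := GRing.PzSemiRing_isNonZero.Build D D1.
pose D' : comNzRingType := HB.pack (GRing.ComPzRing.sort D) nz.
pose k : {rmorphism {mpoly K[n]} -> D'} := mmap (f : {rmorphism K -> D'}) h.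
exists k; split=> [c|i]; first exact: (@mmapC _ _ D' h f).
by rewrite [LHS](@mmapX _ _ D' h f) mmap1U.
Qed.

End PolynomialMorphisms.

(** Each pure tensor is the product of its left and right parts, and pure tensors generate the
    tensor product additively. *)
Lemma tensor_rmorph_ext (A B C : comPzRingType) (f : {rmorphism A -> B})
    (g : {rmorphism A -> C}) (D : comPzRingType)
    (u v : {rmorphism tensor f g -> D}) :
  (forall b, u (tensl f g b) = v (tensl f g b)) ->
  (forall c, u (tensr f g c) = v (tensr f g c)) -> u =1 v.
Proof.
move=> uvl uvr X; rewrite -[X]treprK.
elim/freeg_addind: (trepr X) => [[b c]||x y IHx IHy].
- have -> : tpi f g << (b, c) >> = tensl f g b * tensr f g c.
    by rewrite [RHS]tensM mulr1 mul1r.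
  by rewrite !rmorphM uvl uvr.
- by rewrite !raddf0.
- by rewrite !raddfB /= IHx IHy.
Qed.

(** * The bilinear form and the action of one reflection on polynomials *)

Section Geometry.
Variables (K : realType) (C : coxeterSystem).
Local Notation S := (cox_gens C).
Local Notation N := #|{: S}|.
Local Notation V := 'rV[K]_N.
Local Notation R := (symV K C).
Implicit Types (s t : S) (x y : V) (X : bsData K C).

Local Notation form := (@geom_form K C).
Local Notation root := (@simple_root K C).
Local Notation lin := (@linear_poly K C).
(** Half of the usual coroot pairing: since [alpha_s] has norm 1, the reflection subtracts
    [2 * coroot s i] times [alpha_s] from ['X_i]. *)
Local Notation coroot s := (fun i : 'I_N => form (root (enum_val i)) (root s)).

Lemma geom_formDl x y z : form (x + y) z = form x z + form y z.
Proof.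
rewrite /geom_form -big_split; apply: eq_bigr => s _.
by rewrite -big_split; apply: eq_bigr => t _; rewrite mxE !mulrDl.
Qed.

Lemma geom_formZl a x z : form (a *: x) z = a * form x z.
Proof.
rewrite /geom_form mulr_sumr; apply: eq_bigr => s _.
by rewrite mulr_sumr; apply: eq_bigr => t _; rewrite mxE !mulrA.
Qed.

Lemma geom_form_suml (I : finType) (F : I -> V) z :
  form (\sum_i F i) z = \sum_i form (F i) z.
Proof.
apply: (big_morph (form^~ z) (fun x y => geom_formDl x y z)).
by rewrite -[0](scale0r (0 : V)) geom_formZl mul0r.
Qed.

Lemma geom_form_root s t : form (root s) (root t) = - cos (cox_angle K s t).
Proof.
rewrite /geom_form (bigD1 s) //= [X in _ + X]big1 ?addr0 => [|s' ns]; last first.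
  apply: big1 => t' _; rewrite [root s _ _]mxE eqxx /=.
  by rewrite (inj_eq enum_rank_inj) (negbTE ns) !mul0r.
rewrite (bigD1 t) //= [X in _ + X]big1 ?addr0 => [|t' nt]; last first.
  rewrite [root t _ _]mxE eqxx /=.
  by rewrite (inj_eq enum_rank_inj) (negbTE nt) mulr0 !mul0r.
by rewrite !mxE !eqxx !mul1r.
Qed.

Lemma geom_form_root_diag s : form (root s) (root s) = 1.
Proof. by rewrite geom_form_root /cox_angle cox_m_diag divr1 cospi opprK. Qed.

Lemma root_sum x : x = \sum_(i < N) x 0 i *: root (enum_val i).
Proof.
rewrite [LHS]row_sum_delta; apply: eq_bigr => i _.
by rewrite /simple_root enum_valK.
Qed.

Lemma geom_form_sum x z :
  form x z = \sum_(i < N) x 0 i * form (root (enum_val i)) z.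
Proof.
rewrite {1}[x]root_sum geom_form_suml; apply: eq_bigr => i _.
by rewrite geom_formZl.
Qed.

Lemma linear_polyB x y : lin (x - y) = lin x - lin y.
Proof.
rewrite /linear_poly -sumrB; apply: eq_bigr => i _.
by rewrite !mxE scalerBl.
Qed.

Lemma linear_polyZ a x : lin (a *: x) = a *: lin x.
Proof.
rewrite /linear_poly scaler_sumr; apply: eq_bigr => i _.
by rewrite mxE scalerA.
Qed.

Lemma linear_poly_root s : lin (root s) = 'X_(enum_rank s).
Proof.
rewrite /linear_poly (bigD1 (enum_rank s)) //= big1 => [|i ni].
  by rewrite mxE !eqxx scale1r addr0.
by rewrite mxE (negbTE ni) andbF scale0r.
Qed.

Lemma sym_actD s (p q : R) : sym_act s (p + q) = sym_act s p + sym_act s q.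
Proof. exact: comp_mpolyD. Qed.

Lemma sym_actM s (p q : R) : sym_act s (p * q) = sym_act s p * sym_act s q.
Proof. by rewrite /sym_act rmorphM. Qed.

Lemma sym_actC s (c : K) : sym_act s (c%:MP : R) = c%:MP.
Proof. exact: comp_mpolyC. Qed.

Lemma sym_actX s i :
  sym_act s ('X_i : R) = 'X_i - (2 * coroot s i) *: lin (root s).
Proof.
rewrite /sym_act comp_mpolyXU -tnth_nth tnth_mktuple /geom_refl.
by rewrite linear_polyB linear_polyZ linear_poly_root enum_valK.
Qed.

Lemma sym_act_root s : sym_act s (lin (root s)) = - lin (root s).
Proof.
rewrite {1}linear_poly_root sym_actX enum_rankK geom_form_root_diag mulr1.
by rewrite linear_poly_root -{1}['X__]scale1r -scalerBl opprD addNKr scaleN1r.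
Qed.

(** Since [alpha_s] has norm 1, this is the component of ['X_i] orthogonal to [alpha_s], which the
    reflection fixes. *)
Lemma sym_act_var s i :
  sym_act s ('X_i - (coroot s i)%:MP * lin (root s)) =
  'X_i - (coroot s i)%:MP * lin (root s).
Proof.
rewrite -mulNr -mpolyCN sym_actD sym_actM sym_actC sym_actX sym_act_root.
by rewrite -mul_mpolyC mulr_natl mulr2n mpolyCD mpolyCN; ring.
Qed.

(* Every p is f + alpha_s * h with f and h invariant, and k agrees with g on  *)
(* both; the relation on u says that k and g agree on alpha_s ^+ 2.           *)
Lemma rmorph_eq_on_invariants s (D : comPzRingType) (g k : {rmorphism R -> D})
    (u : D) :
  (forall c : K, k c%:MP = g c%:MP) ->
  (forall i, k 'X_i = g 'X_i + g (coroot s i)%:MP * u) ->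
  u * (u + g (lin (root s)) *+ 2) = 0 ->
  forall p, Defs.invariant s p -> k p = g p.
Proof.
move=> kC kX u0; set a := lin (root s) in u0 *.
have ka : k a = g a + u.
  rewrite /a linear_poly_root kX enum_rankK geom_form_root_diag.
  by rewrite rmorph1 mul1r.
have kaa : k (a * a) = g (a * a).
  rewrite !rmorphM ka.
  suff -> : (g a + u) * (g a + u) = g a * g a + u * (u + g a *+ 2).
    by rewrite u0 addr0.
  ring.
have act_a : sym_act s a = - a := sym_act_root s.
have dec p : exists f h, [/\ p = f + a * h, sym_act s f = f, sym_act s h = h,
    k f = g f & k h = g h].
  elim/mpoly_ring_ind: p => [c|i|p q|p q].
  - exists c%:MP, 0; rewrite mulr0 addr0 !(rmorph0 k, rmorph0 g) kC -mpolyC0.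
    by rewrite !sym_actC.
  - exists ('X_i - (coroot s i)%:MP * a), (coroot s i)%:MP; split=> //.
    + by rewrite mulrC subrK.
    + exact: sym_act_var.
    + exact: sym_actC.
    + rewrite !rmorphB !rmorphM /= kX kC ka mulrDr opprD addrACA.
      by rewrite subrr addr0.
  - case=> [f [h [-> sf sh kf kh]]] [f' [h' [-> sf' sh' kf' kh']]].
    exists (f + f'), (h + h'); rewrite mulrDr addrACA.
    by rewrite !sym_actD !rmorphD sf sf' sh sh' kf kf' kh kh'.
  - case=> [f [h [-> sf sh kf kh]]] [f' [h' [-> sf' sh' kf' kh']]].
    (* Expansion of the product: the term in [a * a] joins the invariant part because the sign of
       [a] cancels. *)
    exists (f * f' + a * a * (h * h')), (f * h' + h * f').
    split.
    + by ring.
    + by rewrite !(sym_actD, sym_actM) sf sf' sh sh' act_a mulrNN.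
    + by rewrite !(sym_actD, sym_actM) sf sf' sh sh'.
    + rewrite !rmorphD (rmorphM k) (rmorphM k (a * a)) (rmorphM k h).
      by rewrite kaa kf kf' kh kh' -!rmorphM.
    + by rewrite !rmorphD !rmorphM kf kf' kh kh'.
move=> p; have [f [h [-> sf sh kf kh]]] := dec p => /eqP.
(* Invariance of [f + a * h] forces [a * h = - (a * h)]. The polynomial ring is a domain and [a] is
   a variable, so [h = 0] and [p = f]. *)
rewrite sym_actD sym_actM sf sh act_a => /addrI/eqP.
rewrite mulNr eq_sym -addr_eq0 -mulr2n -scaler_nat scaler_eq0 pnatr_eq0.
rewrite mulf_eq0 /=.
rewrite {1}/a linear_poly_root => /orP[/eqP X0|/eqP ->].
  have /eqP := congr1 (mcoeff U_(enum_rank s)) X0.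
  by rewrite mcoeffX mcoeff0 eqxx oner_eq0.
by rewrite mulr0 addr0.
Qed.

Lemma rmorph_linear_poly (D : comPzRingType) (k : {rmorphism R -> D}) x :
  k (lin x) = \sum_(i < N) k (x 0 i)%:MP * k 'X_i.
Proof.
by rewrite rmorph_sum; apply: eq_bigr => i _; rewrite -mul_mpolyC rmorphM.
Qed.

Lemma rmorph_linear_poly_shift s (D : comPzRingType) (g k : {rmorphism R -> D})
    (u : D) :
  (forall c : K, k c%:MP = g c%:MP) ->
  (forall i, k 'X_i = g 'X_i + g (coroot s i)%:MP * u) ->
  forall x, k (lin x) = g (lin x) + g (form x (root s))%:MP * u.
Proof.
move=> kC kX x; rewrite !rmorph_linear_poly geom_form_sum.
rewrite (raddf_sum (@mpolyC N K)) rmorph_sum mulr_suml -big_split.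
by apply: eq_bigr => i _ /=; rewrite kC kX mpolyCM rmorphM mulrDr mulrA.
Qed.

(** * The grading on Bott-Samelson rings *)

Record bs_graded X : Prop := BSGraded {
  bs_lastC : forall c : K, bs_last X c%:MP = bs_scal X c;
  bs_homog0 : forall d, bs_homog d (0 : bs_ring X);
  bs_homogD : forall d (a b : bs_ring X),
    bs_homog d a -> bs_homog d b -> bs_homog d (a + b);
  bs_homogM : forall d e (a b : bs_ring X),
    bs_homog d a -> bs_homog e b -> bs_homog (d + e) (a * b);
  bs_homog_last : forall d (p : R), p \is d.-homog -> bs_homog d (bs_last X p)
}.

Lemma bs_homog_scal X c : bs_graded X -> bs_homog 0 (bs_scal X c).
Proof.
move=> gX; rewrite -bs_lastC //; apply: bs_homog_last => //.
by rewrite -[c%:MP]mulr1 mul_mpolyC; apply/dhomogZ/dhomog1.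
Qed.

Lemma bs_homog1 X : bs_graded X -> bs_homog 0 (1 : bs_ring X).
Proof. by move=> gX; rewrite -(rmorph1 (bs_scal X)); apply: bs_homog_scal. Qed.

Lemma bs_homog_sum X (I : eqType) (r : seq I) (F : I -> bs_ring X) d :
  bs_graded X -> (forall i, i \in r -> bs_homog d (F i)) ->
  bs_homog d (\sum_(i <- r) F i).
Proof.
move=> gX; elim: r => [|i r IH] Fr; rewrite ?big_nil ?big_cons.
  exact: bs_homog0.
apply: bs_homogD => //; first by apply: Fr; rewrite mem_head.
by apply: IH => j jr; apply: Fr; rewrite inE jr orbT.
Qed.

Lemma bs_nil_graded : bs_graded (bs_nil K C).
Proof.
split=> [c|d|d a b|d e a b|d p hp] /=.
- by rewrite mcoeffC eqxx mulr1.
- by right.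
- by case=> ->; [left|rewrite add0r].
- by case=> ->; [case=> ->; [left|right; rewrite mulr0]|right; rewrite mul0r].
- case: d hp => [|d] hp; [by left|right].
  by apply: (dhomog_nemf_coeff hp); rewrite mf0.
Qed.

(** * Adjoining one tensor factor: its generator and relation *)

Section Step.
Variables (X : bsData K C) (s : S).
Hypothesis gX : bs_graded X.
Local Notation tn := (tens (step_left X s) (inv_incl K s)).
Local Notation tl := (tensl (step_left X s) (inv_incl K s)).
Local Notation tr := (tensr (step_left X s) (inv_incl K s)).

Lemma step_homog_tens i j b (r : R) : bs_homog i b -> r \is j.-homog ->
  bs_homog (b := bs_step X s) (i + j) (tn b r).
Proof.
move=> hb hr; exists [:: (b, r)]; first by rewrite big_seq1.
by move=> p; rewrite inE => /eqP ->; exists i, j.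
Qed.

Lemma tensl_last (p : R) : Defs.invariant s p -> tl (bs_last X p) = tr p.
Proof.
move=> sp; have := tensA (step_left X s) (inv_incl K s) (InvRing sp) 1 1.
by rewrite mul1r mulr1.
Qed.

Lemma bs_step_graded : bs_graded (bs_step X s).
Proof.
split=> [c|d|d a b [r -> hr] [r' -> hr']|d e a b [r -> hr] [r' -> hr']|d p hp].
- rewrite /= -bs_lastC // tensl_last //; exact/eqP/sym_actC.
- by exists [::]; rewrite ?big_nil.
- exists (r ++ r'); first by rewrite big_cat.
  by move=> p; rewrite mem_cat => /orP[/hr|/hr'].
- exists [seq (p.1 * q.1, p.2 * q.2) | p <- r, q <- r'].
    rewrite big_allpairs_dep /= mulr_suml; apply: eq_bigr => p _.
    by rewrite mulr_sumr; apply: eq_bigr => q _; rewrite tensM.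
  move=> _ /allpairsP[[p q] [/hr[i [j [<- hp1 hp2]]]
    /hr'[i' [j' [<- hq1 hq2]]] ->]].
  exists (i + i')%N, (j + j')%N; split; first by rewrite addnACA.
    exact: bs_homogM.
  exact: dhomogM.
- by apply: (@step_homog_tens 0 d) => //; apply: bs_homog1.
Qed.

Lemma tensl_homog d b :
  bs_homog d b -> bs_homog (b := bs_step X s) d (tl b).
Proof.
by move=> hb; rewrite -[d]addn0; apply: step_homog_tens => //; apply: dhomog1.
Qed.

(** The element [u_j] of the overview, of degree 1; it measures the failure of [alpha_s] to move
    across the new tensor sign. *)
Definition step_gen : bs_ring (bs_step X s) :=
  tr (lin (root s)) - tl (bs_last X (lin (root s))).

(* This is the relation (1 (x) alpha_s) ^+ 2 = (alpha_s (x) 1) ^+ 2. *)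
Lemma step_gen_rel :
  step_gen * (step_gen + tl (bs_last X (lin (root s))) *+ 2) = 0.
Proof.
set a := lin (root s).
have E : tl (bs_last X a) * tl (bs_last X a) = tr a * tr a.
  rewrite -(rmorphM (bs_last X \; tl)) -(rmorphM tr) /= tensl_last //.
  by rewrite /Defs.invariant sym_actM !sym_act_root mulrNN.
rewrite /step_gen -/a; move: E; move: (tl _) (tr _) => y z E.
by rewrite mulr2n addrA subrK -subr_sqr !expr2 E subrr.
Qed.

(** The invariant form [x - (x, alpha_s) alpha_s] moves across the tensor sign, so only the multiple
    of [alpha_s] contributes a correction. *)
Lemma tensr_linear x :
    tr (lin x) =
    tl (bs_last X (lin x)) + tl (bs_scal X (form x (root s))) * step_gen.
Proof.
rewrite -bs_lastC //.
apply: (@rmorph_linear_poly_shift s _ (tl \o bs_last X) tr step_gen) => [c|i] /=.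
  by rewrite tensl_last //; exact/eqP/sym_actC.
have := tensl_last (introT eqP (sym_act_var s i)).
rewrite /step_gen !rmorphB !rmorphM /= => /eqP; rewrite subr_eq => /eqP ->.
rewrite (tensl_last (introT eqP (sym_actC s _))).
by rewrite -addrA -mulrDr subrKC subrK.
Qed.

End Step.

End Geometry.

(** * Comparison of the rings of two expressions *)

Section Comparison.
Variable K : realType.
Local Notation root := (@simple_root K _).
Local Notation form := (@geom_form K _).
Local Notation lin := (@linear_poly K _).
Local Notation V C := 'rV[K]_#|{: cox_gens C}|.
Local Notation tl X s := (tensl (step_left X s) (inv_incl K s)).
Local Notation tr X s := (tensr (step_left X s) (inv_incl K s)).

(** The relation [M] takes the place of a linear map between the two spaces; it may shrink as
    factors are adjoined. *)
Record bs_morph (C C' : coxeterSystem) (X : bsData K C) (X' : bsData K C')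
    (M : V C -> V C' -> Prop) (phi : {rmorphism bs_ring X -> bs_ring X'}) :
    Prop := BSMorph {
  bs_morph_scal : forall c, phi (bs_scal X c) = bs_scal X' c;
  bs_morph_homog : forall d b, bs_homog d b -> bs_homog d (phi b);
  bs_morph_last : forall x x', M x x' ->
    phi (bs_last X (lin x)) = bs_last X' (lin x')
}.

(** When [X] is graded, these conditions determine [psi]: the left part and [step_gen] generate the
    new ring. *)
Definition step_extension (C C' : coxeterSystem) (X : bsData K C)
    (X' : bsData K C') s s' (phi : {rmorphism bs_ring X -> bs_ring X'})
    (psi : {rmorphism bs_ring (bs_step X s) -> bs_ring (bs_step X' s')}) :=
  (forall b, psi (tl X s b) = tl X' s' (phi b)) /\
  psi (step_gen X s) = step_gen X' s'.

(** The universal property glues [phi] on the left with a morphism [k] on the new factor; the work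
    is to show that they agree on invariants. *)
Lemma bs_morph_step (C C' : coxeterSystem) (X : bsData K C) (X' : bsData K C')
    s s' (M M' : V C -> V C' -> Prop)
    (phi : {rmorphism bs_ring X -> bs_ring X'}) :
  bs_graded X -> bs_graded X' -> bs_morph M phi -> M (root s) (root s') ->
  (forall x x', M' x x' -> M x x' /\ form x (root s) = form x' (root s')) ->
  exists2 psi : {rmorphism bs_ring (bs_step X s) -> bs_ring (bs_step X' s')},
    bs_morph M' psi & step_extension phi psi.
Proof.
move=> gX gX' [phi_scal phi_homog phi_last] Ms M'M.
have gS := bs_step_graded s gX; have gS' := bs_step_graded s' gX'.
pose g : {rmorphism bs_ring X -> bs_ring (bs_step X' s')} := tl X' s' \o phi.
pose co (i : 'I_#|{: cox_gens C}|) := form (root (enum_val i)) (root s).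
(* The values on variables copy the formula of [tensr_linear], with pairings from the source and the
   generator from the target. *)
have [k [kC kX]] := mpoly_lift (bs_scal (bs_step X' s'))
  (fun i => g (bs_last X 'X_i) +
    bs_scal (bs_step X' s') (co i) * step_gen X' s').
have gC c : g (bs_last X c%:MP) = bs_scal (bs_step X' s') c.
  by rewrite /= (bs_lastC gX) phi_scal.
have k_lin x : k (lin x) =
    g (bs_last X (lin x)) +
    bs_scal (bs_step X' s') (form x (root s)) * step_gen X' s'.
  rewrite -gC; apply: (@rmorph_linear_poly_shift _ _ s _ (g \o bs_last X)).
    by move=> c; rewrite kC -gC.
  by move=> i; rewrite kX -gC.
have k_inv a : g (step_left X s a) = k (inv_incl K s a).
  case: a => p sp; rewrite /step_left /=; apply/esym.
  apply: (@rmorph_eq_on_invariants _ _ s _ (g \o bs_last X) k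
    (step_gen X' s')) => //.
  - by move=> c; rewrite kC -gC.
  - by move=> i; rewrite kX -gC.
  (* By [Ms], [g] sends [alpha_s] to the left image of the root of [s'], so the required relation is
     the one in the target. *)
  - by rewrite /= (phi_last _ _ Ms) step_gen_rel.
have [psi psiE] := tensor_lift k_inv.
have psi_l b : psi (tl X s b) = g b by rewrite psiE rmorph1 mulr1.
have psi_r p : psi (tr X s p) = k p by rewrite psiE rmorph1 mul1r.
exists psi; first split.
- by move=> c; rewrite /= psi_l /= phi_scal.
(* Degrees are checked monomial by monomial, since [k] sends each variable to an element of degree
   1. *)
- have k_homog d p : p \is d.-homog -> bs_homog (b := bs_step X' s') d (k p).
    move=> /dhomogP hp; rewrite [p]mpolyE rmorph_sum; apply: bs_homog_sum => // m.
    move=> /hp <-; rewrite -mul_mpolyC rmorphM kC -[X in bs_homog X]add0n.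
    apply: bs_homogM => //; first exact: bs_homog_scal.
    rewrite mpolyXE_id rmorph_prod /= mdegE.
    apply: (big_ind2 (fun e b => bs_homog (b := bs_step X' s') e b)) => //.
    + exact: bs_homog1.
    + by move=> *; apply: bs_homogM.
    move=> i _; rewrite rmorphXn.
    elim: (m i) => [|e IH]; first by rewrite expr0; apply: bs_homog1.
    rewrite exprS -add1n; apply: bs_homogM => //.
    have hX (C0 : coxeterSystem) (j : 'I_#|{: cox_gens C0}|) :
      ('X_j : symV K C0) \is 1.-homog by rewrite dhomogX /= mdeg1.
    have hlin (C0 : coxeterSystem) x : (lin x : symV K C0) \is 1.-homog.
      by apply: rpred_sum => j _; apply/dhomogZ/hX.
    rewrite kX; apply: bs_homogD => //.
      by apply/tensl_homog/phi_homog => //; apply: bs_homog_last.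
    rewrite -[1%N]add0n; apply: bs_homogM => //; first exact: bs_homog_scal.
    rewrite /step_gen -mulN1r -(rmorph1 (bs_scal (bs_step X' s'))) -rmorphN.
    apply: bs_homogD => //; first exact: (bs_homog_last gS').
    rewrite -[1%N]add0n; apply: bs_homogM => //; first exact: bs_homog_scal.
    by apply: tensl_homog => //; apply: bs_homog_last.
  move=> d _ [r -> hr]; rewrite rmorph_sum; apply: bs_homog_sum => // p.
  move=> /hr[i [j [<- hi hj]]]; rewrite psiE; apply: bs_homogM => //.
    by apply/tensl_homog/phi_homog.
  exact: k_homog.
- move=> x x' /M'M[Mx ex]; rewrite [LHS]psi_r [RHS]tensr_linear // k_lin ex.
  by rewrite /= (phi_last _ _ Mx).
(* The left parts cancel, and the coefficient of the target generator is
   [(alpha_s, alpha_s) = 1]. *)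
split=> //; rewrite /step_gen rmorphB psi_l psi_r k_lin geom_form_root_diag.
by rewrite rmorph1 mul1r addrC addKr.
Qed.

Lemma step_extension_cancel (C C' : coxeterSystem) (X : bsData K C)
    (X' : bsData K C') s s'
    (phi : {rmorphism bs_ring X -> bs_ring X'})
    (phi' : {rmorphism bs_ring X' -> bs_ring X})
    (psi : {rmorphism bs_ring (bs_step X s) -> bs_ring (bs_step X' s')})
    (psi' : {rmorphism bs_ring (bs_step X' s') -> bs_ring (bs_step X s)}) :
  bs_graded X ->
  step_extension phi psi -> step_extension phi' psi' ->
  cancel phi phi' -> cancel psi psi'.
Proof.
move=> gX [psi_l psi_g] [psi'_l psi'_g] phiK.
have cl b : psi' (psi (tl X s b)) = tl X s b by rewrite psi_l psi'_l phiK.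
apply: (tensor_rmorph_ext (u := psi' \o psi) (v := idfun)) => // p /=.
pose g : {rmorphism symV K C -> bs_ring (bs_step X s)} := psi' \o psi \o tr X s.
suff E : g =1 tr X s by exact: (E p).
apply: mpoly_rmorph_ext => [c|i].
  have /= E := bs_lastC (bs_step_graded s gX) c.
  by rewrite /g /= E cl.
(* Each variable is a simple root, hence a combination of left elements and [step_gen], all fixed by
   the composite. *)
rewrite -[i]enum_valK -linear_poly_root /g /= tensr_linear //.
rewrite (rmorphD psi) (rmorphM psi) (rmorphD psi') (rmorphM psi') !cl psi_g.
by rewrite psi'_g.
Qed.

Definition same_pairings (C C' : coxeterSystem)
    (l : seq (cox_gens C * cox_gens C')) (x : V C) (x' : V C') :=
  forall p, p \in l -> form x (root p.1) = form x' (root p.2).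

Lemma bs_data_graded (C : coxeterSystem) w : bs_graded (@bs_data K C w).
Proof.
rewrite /bs_data; elim/last_ind: w => [|w s IH]; first exact: bs_nil_graded.
by rewrite foldl_rcons; apply: bs_step_graded.
Qed.

(** Induction on the last letter. A single list of pairs keeps the expressions aligned, and both
    directions are built together so that they stay mutually inverse. *)
Lemma bs_data_iso (C C' : coxeterSystem) (l : seq (cox_gens C * cox_gens C')) :
  (forall p q, p \in l -> q \in l -> cox_m p.1 q.1 = cox_m p.2 q.2) ->
  exists (phi : {rmorphism bs_ring (@bs_data K C (unzip1 l)) ->
                 bs_ring (@bs_data K C' (unzip2 l))})
         (psi : {rmorphism bs_ring (@bs_data K C' (unzip2 l)) ->
                 bs_ring (@bs_data K C (unzip1 l))}),
    [/\ bs_morph (same_pairings l) phi,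
        bs_morph (fun x' x => same_pairings l x x') psi,
        cancel phi psi & cancel psi phi].
Proof.
elim/last_ind: l => [|l [s s'] IH] ml.
  (* For empty expressions all linear forms map to 0, so any two of them have matching images. *)
  have lin0 (C0 : coxeterSystem) (x : V C0) : mcoeff 0%MM (lin x) = 0.
    rewrite raddf_sum big1 // => i _ /=.
    by rewrite mcoeffZ mcoeffX -mdeg_eq0 ?mdeg1 mulr0.
  exists (idfun : {rmorphism K -> K}), (idfun : {rmorphism K -> K}).
  by split=> //; split=> // x x' _; rewrite /= !lin0.
have [|phi [psi [mphi mpsi phiK psiK]]] := IH.
  by move=> p q pl ql; apply: ml; rewrite mem_rcons inE ?pl ?ql orbT.
have gX := bs_data_graded (unzip1 l); have gX' := bs_data_graded (unzip2 l).
(* The new roots qualify because their pairings with the earlier roots are cosines determined by the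
   labels. *)
have Ms : same_pairings l (root s) (root s').
  move=> p pl; rewrite !geom_form_root /cox_angle.
  by rewrite (ml (s, s') p) // mem_rcons inE ?eqxx // pl orbT.
have step_pairings x x' : same_pairings (rcons l (s, s')) x x' ->
    same_pairings l x x' /\ form x (root s) = form x' (root s').
  move=> xx'; split=> [p pl|]; first by apply: xx'; rewrite mem_rcons inE pl orbT.
  by apply: (xx' (s, s')); rewrite mem_rcons mem_head.
have [phi' mphi' ephi] := bs_morph_step gX gX' mphi Ms step_pairings.
have [|psi' mpsi' epsi] := bs_morph_step gX' gX mpsi Ms
    (M' := fun x' x => same_pairings (rcons l (s, s')) x x').
  by move=> x' x /step_pairings[? ->].
rewrite /unzip1 /unzip2 !map_rcons /bs_data !foldl_rcons.
exists phi', psi'; split=> //.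
- exact: step_extension_cancel ephi epsi phiK.
- exact: step_extension_cancel epsi ephi psiK.
Qed.

End Comparison.

Theorem corollary3p5 (K : realType) (C C' : coxeterSystem) (n : nat)
    (w : n.-tuple (cox_gens C)) (w' : n.-tuple (cox_gens C')) :
  (forall i j : 'I_n, (i <= j)%N ->
     cox_m (tnth w i) (tnth w j) = cox_m (tnth w' i) (tnth w' j)) ->
  exists phi : {lrmorphism BS K w -> BS K w'},
    bijective phi /\
    (forall (d : nat) (x : BS K w), BS_homog d x <-> BS_homog d (phi x)).
Proof.
move=> mww'.
(* Symmetry of the labels removes the restriction [i <= j]. *)
have mtotal i j : cox_m (tnth w i) (tnth w j) = cox_m (tnth w' i) (tnth w' j).
  have [/mww' //|/ltnW/mww' e] := leqP i j.
  by rewrite cox_m_sym e cox_m_sym.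
pose l := [seq (tnth w i, tnth w' i) | i <- enum 'I_n].
have /(bs_data_iso K) : forall p q, p \in l -> q \in l ->
    cox_m p.1 q.1 = cox_m p.2 q.2.
  by move=> _ _ /mapP[i _ ->] /mapP[j _ ->]; apply: mtotal.
have -> : unzip1 l = w by rewrite /unzip1 -map_comp map_tnth_enum.
have -> : unzip2 l = w' by rewrite /unzip2 -map_comp map_tnth_enum.
case=> phi [psi [[phi_scal phi_homog _] [_ psi_homog _] phiK psiK]].
pose f : BS K w -> BS K w' := phi.
have fB : zmod_morphism f by move=> x y; apply: raddfB.
have fM : monoid_morphism f by split=> [|x y]; [apply: rmorph1|apply: rmorphM].
have fZ : scalable f.
  by move=> a x; rewrite /f /GRing.scale /= /BS_scale rmorphM phi_scal.
pose fa := GRing.isZmodMorphism.Build _ _ f fB.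
pose fm := GRing.isMonoidMorphism.Build _ _ f fM.
pose fz := GRing.isScalable.Build _ _ _ _ f fZ.
pose F : {lrmorphism BS K w -> BS K w'} := HB.pack f fa fm fz.
exists F; split=> [|d x]; first by exists psi.
(* The inverse preserves degrees as well, which gives the converse. *)
split=> [|/psi_homog]; first exact: phi_homog.
by rewrite phiK.
Qed.
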